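(* Let $\widehat{A}=A+\varepsilon B$ be an $n\times n$ dual matrix with $A,B\in\mathbb{R}^{n\times n}$ and $\mathrm{rank}(A)=r$. Then the dual index of $\widehat{A}$ is equal to one if and only if $\mathrm{Ind}(A)=1$ and $$\mathrm{rank}\left(\begin{bmatrix}B & A\\ A & 0\end{bmatrix}\right)=2\,\mathrm{rank}(A).$$
   Context: Dual numbers are $a+\varepsilon a'$ with $a,a'\in\mathbb{R}$ and $\varepsilon\neq 0$, $\varepsilon^2=0$ (i.e. the ring $\mathbb{R}[\varepsilon]/(\varepsilon^2)$). A dual matrix is a matrix over dual numbers, written $\widehat{A}=A+\varepsilon B$ with $A,B$ real. The range $\mathcal{R}(\widehat{A})$ of an $n\times n$ dual matrix is $\{\widehat{A}\widehat{x}: \widehat{x}$ a dual column vector of length $n\}$. The dual index of an $n\times n$ dual matrix $\widehat{A}$ is said to be equal to one if $\mathcal{R}(\widehat{A}^2)=\mathcal{R}(\widehat{A})$. For a real square matrix $A$, ''$\mathrm{Ind}(A)=1$'' means $\mathrm{rank}(A^2)=\mathrm{rank}(A)$. *)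

(* Defs.v *)
From HB Require Import structures.
From mathcomp Require Import all_boot all_order all_algebra.
From mathcomp Require Import boolp classical_sets reals.

Set Implicit Arguments.
Unset Strict Implicit.
Unset Printing Implicit Defensive.

Import GRing.Theory.
Local Open Scope ring_scope.

(* The ring R[X]/(X^2).  {poly %/ h} falls back to the modulus 'X when h is
   constant or not monic; [mk_monic_X2] rules this out for h = 'X^2. *)
Notation dualnum R := {poly %/ ('X^2 : {poly R})}.

Section Dual.
Variable R : realType.

Definition dual_eps : dualnum R := 'qX.

Definition dual_of_real (a : R) : dualnum R := qpolyC 'X^2 a.

Definition dualmx (m n : nat) (A B : 'M[R]_(m, n)) : 'M[dualnum R]_(m, n) :=
  map_mx dual_of_real A + dual_eps *: map_mx dual_of_real B.

Definition mxrange (n : nat) (M : 'M[dualnum R]_n) : set 'cV[dualnum R]_n :=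
  range (fun x : 'cV[dualnum R]_n => M *m x).

Definition dual_index_one (n : nat) (M : 'M[dualnum R]_n) : Prop :=
  mxrange (M *m M) = mxrange M.

Definition index_one (n : nat) (A : 'M[R]_n) : Prop :=
  \rank (A *m A) = \rank A.

Lemma mk_monic_X2 : mk_monic ('X^2 : {poly R}) = 'X^2.
Proof. exact: mk_monic_Xn. Qed.

Lemma val_dual_eps : dual_eps = 'X :> {poly R}.
Proof. by rewrite /dual_eps qpolyXE ?size_polyXn ?monicXn. Qed.

Lemma dual_eps_neq0 : dual_eps != 0.
Proof.
apply/eqP => /(congr1 (fun z : dualnum R => (z : {poly R}))).
by rewrite val_dual_eps => /eqP; rewrite polyX_eq0.
Qed.

Lemma dual_eps_sqr : dual_eps ^+ 2 = 0.
Proof.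
rewrite /dual_eps /qpolyX -rmorphXn /=; apply: val_inj => /=.
by rewrite mk_monic_X2 Pdiv.RingMonic.rmodpp ?monicXn.
Qed.

Lemma val_dual (a b : R) :
  dual_of_real a + dual_eps * dual_of_real b = a%:P + b *: 'X :> {poly R}.
Proof.
have -> : dual_eps * dual_of_real b = in_qpoly 'X^2 (b *: 'X).
  apply: val_inj; change (Pdiv.Ring.rmodp ((dual_eps : {poly R}) * b%:P)
    (mk_monic 'X^2) = Pdiv.Ring.rmodp (b *: 'X) (mk_monic 'X^2)).
  by rewrite val_dual_eps mulrC mul_polyC.
rewrite /= Pdiv.CommonRing.rmodp_small // mk_monic_X2 size_polyXn ltnS.
by rewrite (leq_trans (size_scale_leq _ _)) ?size_polyX.
Qed.

Lemma dual_decomp (z : dualnum R) :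
  exists a b : R, z = dual_of_real a + dual_eps * dual_of_real b.
Proof.
have sz : (size (z : {poly R}) <= 2)%N.
  have sh : (size (mk_monic ('X^2 : {poly R})) <= 3)%N.
    by rewrite mk_monic_X2 size_polyXn.
  by rewrite -ltnS (leq_trans (size_mk_monic z)).
exists (z : {poly R})`_0, (z : {poly R})`_1; apply: val_inj.
rewrite [RHS]val_dual; apply/polyP => i.
rewrite coefD coefC coefZ coefX.
case: i => [|[|i]] /=; rewrite ?mulr0 ?mulr1 ?addr0 ?add0r //.
by rewrite nth_default // (leq_trans sz).
Qed.

Lemma dual_decomp_inj (a b c d : R) :
  dual_of_real a + dual_eps * dual_of_real b =
  dual_of_real c + dual_eps * dual_of_real d -> a = c /\ b = d.
Proof.
move=> /(congr1 (fun z : dualnum R => (z : {poly R}))).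
rewrite !val_dual => /polyP E; move: (E 0%N) (E 1%N).
by rewrite !coefD !coefC !coefZ !coefX /= !mulr0 !mulr1 !addr0 !add0r.
Qed.

End Dual.

(* Main.v *)
(* The dual index of M = A + eps B is one iff M = M^2 (X + eps Y) is solvable,
   that is A = A^2 X and B = A^2 Y + (A B + B A) X.  The block rank condition
   says exactly that B = A P + Q A for some P, Q.  Since ker A^2 = ker A, any X
   with A = A^2 X satisfies A X A = A and A X = A X^2 A; hence B A X is a left
   multiple of A, which gives one direction, while B = A P + Q A yields
   B - B A X = A (P - P A X), so that Y = X (P - P A X - B X) gives the other. *)

Require Import Defs.
From mathcomp Require Import all_boot all_order all_algebra.
From mathcomp Require Import reals.
From mathcomp Require Import boolp classical_sets.

Set Implicit Arguments.
Unset Strict Implicit.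
Unset Printing Implicit Defensive.

Import GRing.Theory.
Local Open Scope ring_scope.

Section RealMatrices.
Variable F : fieldType.

(** Transposes appear because [submx] compares row spaces, while the factor [W] is about column
    spaces: that of [A *m A] lies in that of [A], and equal ranks make them coincide. *)
Lemma index1_rmulP n (A : 'M[F]_n) :
  reflect (exists W, A = A *m A *m W) (\rank (A *m A) == \rank A).
Proof.
have sAA : ((A *m A)^T <= A^T)%MS by rewrite trmx_mul submxMl.
rewrite -[\rank (A *m A)]mxrank_tr -[X in _ == X]mxrank_tr.
rewrite (mxrank_leqif_sup sAA).
apply: (iffP submxP) => [[D eD]|[W eW]].
  by exists D^T; apply: trmx_inj; rewrite trmx_mul trmxK.
by exists W^T; rewrite {1}eW trmx_mul.
Qed.

(** Equal ranks also equate the row spaces, so [A] is a left multiple of [A *m A]. *)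
Lemma index1_mul_eq0 n p (A : 'M[F]_n) (Z : 'M[F]_(n, p)) :
  \rank (A *m A) = \rank A -> A *m A *m Z = 0 -> A *m Z = 0.
Proof.
move=> rA AAZ; have /submxP[D ->] : (A <= A *m A)%MS.
  by rewrite -(mxrank_leqif_sup (submxMl A A)).2 rA.
by rewrite -mulmxA AAZ mulmx0.
Qed.

Lemma index1_rmul_inner n (A W : 'M[F]_n) :
  A = A *m A *m W -> A *m W *m A = A.
Proof.
move=> eA; have /eqP rA : \rank (A *m A) == \rank A.
  by apply/index1_rmulP; exists W.
(* [A *m A] annihilates [W *m A - 1%:M], hence so does [A]. *)
apply/eqP; rewrite -subr_eq0 -{3}[A]mulmx1 -mulmxA -mulmxBr; apply/eqP.
by apply: index1_mul_eq0 => //; rewrite mulmxBr mulmx1 !mulmxA -eA subrr.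
Qed.

Lemma rank_block_mxP m n (A B : 'M[F]_(m, n)) :
  reflect (exists P Q, B = A *m P + Q *m A)
    (\rank (block_mx B A A 0) == (2 * \rank A)%N).
Proof.
apply: (iffP eqP) => [rM|[P [Q ->]]].
  (* As [B = A *m G *m B + K *m B], it suffices to show that [K *m B] is a left multiple of [A]. *)
  pose G := pinvmx A; pose K := 1%:M - A *m G.
  have KA : K *m A = 0 by rewrite mulmxBl mul1mx mulmxKpV // subrr.
  (* [row_mx S 0] lies in the row space of the block matrix and in the kernel
     of the second projection [p], which maps that row space onto that of A. *)
  pose S := col_mx (K *m B) A; pose p : 'M[F]_(n + n, n) := col_mx 0 1%:M.
  have rSA : (\rank S <= \rank A)%N.
    have : (row_mx S (0 : 'M_(_, n)) <= block_mx B A A 0 :&: kermx p)%MS.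
      rewrite sub_capmx; apply/andP; split.
        apply/submxP; exists (block_mx K 0 0 1%:M).
        rewrite mulmx_block KA !mul0mx !mul1mx !addr0 !add0r.
        by rewrite block_mxEh; congr row_mx; rewrite col_mx0.
      by apply/sub_kermxP; rewrite mul_row_col mulmx0 mul0mx addr0.
    move/mxrankS; rewrite rank_row_mx0 => /leq_trans; apply.
    (* Rank-nullity for [p]: the image takes up [\rank A] of the total [2 * \rank A]. *)
    rewrite -(leq_add2l (\rank A)) [leqRHS]addnn -[leqRHS]mul2n -rM.
    rewrite -(mxrank_mul_ker (block_mx _ _ _ _) p).
    by rewrite /p mul_block_col !mulmx1 !mulmx0 !add0r rank_col_mx0.
  have AS : (A <= S)%MS by rewrite -addsmxE addsmxSr.
  have : (S <= A)%MS by rewrite -(mxrank_leqif_sup AS).2 eqn_leq mxrankS.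
  rewrite col_mx_sub => /andP[/submxP[D eD] _].
  by exists (G *m B), D; rewrite -eD mulmxBl mul1mx mulmxA addrC subrK.
(* Unitriangular factors clear the corner block without changing the rank; swapping block rows then
   leaves a block diagonal matrix. *)
have -> : block_mx (A *m P + Q *m A) A A 0 =
    block_mx 1%:M Q 0 1%:M *m block_mx 0 A A 0 *m block_mx 1%:M 0 P 1%:M.
  by rewrite !mulmx_block !(mulmx0, mul0mx, mulmx1, mul1mx, addr0, add0r) addrC.
have uU : block_mx 1%:M Q 0 1%:M \in unitmx.
  by rewrite unitmxE det_ublock !det1 mulr1 unitr1.
have uL : block_mx 1%:M 0 P 1%:M \in unitmx.
  by rewrite unitmxE det_lblock !det1 mulr1 unitr1.
rewrite mxrankMfree ?row_free_unit // -mxrank_tr trmx_mul.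
rewrite mxrankMfree ?row_free_unit ?unitmx_tr // mxrank_tr.
rewrite block_mxEv -addsmxE addsmxC addsmxE -block_mxEv rank_diag_block_mx.
by rewrite addnn mul2n.
Qed.

End RealMatrices.

Section DualMatrices.
Variable R : realType.

Lemma mul_dualmx m n p (A B : 'M[R]_(m, n)) (C D : 'M[R]_(n, p)) :
  dualmx A B *m dualmx C D = dualmx (A *m C) (A *m D + B *m C).
Proof.
rewrite /dualmx /dual_of_real.
rewrite map_mxD !map_mxM mulmxDl !mulmxDr -!scalemxAl -!scalemxAr scalerA.
by rewrite -expr2 dual_eps_sqr scale0r addr0 scalerDr addrA.
Qed.

Lemma dualmx_surj m n (M : 'M[dualnum R]_(m, n)) : exists A B, M = dualmx A B.
Proof.
have ex i j : exists z : R * R,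
    M i j = dual_of_real z.1 + dual_eps R * dual_of_real z.2.
  by have [a [b ->]] := dual_decomp (M i j); exists (a, b).
pose f i j := sval (cid (ex i j)).
exists (\matrix_(i, j) (f i j).1), (\matrix_(i, j) (f i j).2).
by apply/matrixP => i j; rewrite !mxE /f; case: cid.
Qed.

Lemma dualmx_inj m n (A B C D : 'M[R]_(m, n)) :
  dualmx A B = dualmx C D -> A = C /\ B = D.
Proof.
move/matrixP => e.
by split; apply/matrixP => i j; have := e i j; rewrite !mxE => /dual_decomp_inj[].
Qed.

Lemma dual_index_one_rmulP n (M : 'M[dualnum R]_n) :
  dual_index_one M <-> exists X, M = M *m M *m X.
Proof.
split=> [e|[X eX]].
  (* [X] is assembled column by column from chosen preimages. *)
  have ex j : exists x, M *m M *m x = col j M.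
    have : mxrange M (col j M) by exists (delta_mx j 0); rewrite // colE.
    by rewrite -e => -[x _ <-]; exists x.
  exists (\matrix_(i, j) sval (cid (ex j)) i 0).
  apply/matrixP => i j.
  have /colP/(_ i) := svalP (cid (ex j)); rewrite [RHS]mxE => <-.
  by rewrite !mxE; apply: eq_bigr => k _; rewrite mxE.
apply/seteqP; split=> _ [x _ <-].
  by exists (M *m x); rewrite ?mulmxA.
by exists (X *m x); rewrite // mulmxA -eX.
Qed.

Lemma dual_index_oneP n (A B : 'M[R]_n) :
  dual_index_one (dualmx A B) <->
  exists X Y, A = A *m A *m X /\
    B = A *m A *m Y + (A *m B + B *m A) *m X.
Proof.
rewrite dual_index_one_rmulP; split=> [[X]|[X [Y [eA eB]]]].
  have [X1 [Y ->]] := dualmx_surj X.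
  by rewrite !mul_dualmx => /dualmx_inj[eA eB]; exists X1, Y.
by exists (dualmx X Y); rewrite !mul_dualmx -eA -eB.
Qed.

End DualMatrices.

Theorem theorem2p3 (R : realType) (n r : nat) (A B : 'M[R]_n)
    (rankA : \rank A = r) :
  dual_index_one (dualmx A B) <->
  index_one A /\ \rank (block_mx B A A 0%R) = (2 * \rank A)%N.
Proof.
rewrite dual_index_oneP; split=> [[X [Y [eA eB]]]|[rA]].
  have rA : \rank (A *m A) = \rank A by apply/eqP/index1_rmulP; exists X.
  split=> //; apply/eqP/rank_block_mxP.
  have AXA := index1_rmul_inner eA.
  have eAX : A *m X = A *m X *m X *m A.
    (* [A *m A] sends both [X] and [X *m X *m A] to [A], the latter by [AXA]. *)
    apply/eqP; rewrite -subr_eq0 -!mulmxA -mulmxBr; apply/eqP.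
    by apply: index1_mul_eq0 => //; rewrite mulmxBr !mulmxA -!eA AXA subrr.
  exists (A *m Y + B *m X), (B *m A *m X *m X).
  rewrite {1}eB mulmxDr mulmxDl !mulmxA -addrA; congr (_ + (_ + _)).
  by rewrite -!mulmxA {1}eAX !mulmxA.
move/eqP/rank_block_mxP=> [P [Q eB]].
have /eqP/index1_rmulP[W eA] := rA.
have BAW : B *m A *m W = A *m P *m A *m W + Q *m A.
  by rewrite eB !mulmxDl -[Q *m A *m A]mulmxA -[Q *m _ *m W]mulmxA -eA.
(* The leading [W] reduces [A *m A] to [A], and [- B *m W] cancels the term [A *m B *m W]. *)
exists W, (W *m (P - P *m A *m W - B *m W)); split=> //.
rewrite mulmxA -eA !mulmxBr mulmxDl BAW !mulmxA {1}eB.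
by rewrite addrA subrK addrA subrK.
Qed.
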